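(* Let $p$ be a prime. Suppose that every $p$-adic Lie group $G$ has closed subgroups $Z\lhd K\lhd G$ such that $Z$ is abelian, $K/Z$ is discrete, and $K=\ker\beta$ for a continuous homomorphism $\beta\colon G\to\mathrm{GL}_d(\mathbb{Q}_p)$ for some $d\in\mathbb{N}$. Then extraordinary $p$-adic Lie groups do not exist.
   Context: $\mathbb{N}=\{1,2,\dots\}$. $p$-adic Lie groups are finite-dimensional analytic Lie groups over $\mathbb{Q}_p$; $\operatorname{Ad}$ denotes the adjoint representation of a $p$-adic Lie group on its Lie algebra. Here $Z\lhd K\lhd G$ means that $Z$ is normal in $K$ and $K$ is normal in $G$. A subgroup $S$ of a group $H$ is subnormal if there is a finite chain $S=S_m\lhd S_{m-1}\lhd\cdots\lhd S_0=H$. For a group $S$, $S'$ denotes the commutator group, generated by all commutators $ghg^{-1}h^{-1}$ with $g,h\in S$. A subgroup is called discrete if it is discrete in the induced topology. A $p$-adic Lie group $H$ is called nearly simple if each closed subnormal subgroup $S\subseteq H$ is open or discrete. A nearly simple $p$-adic Lie group $H$ is called extraordinary if $H=\ker(\operatorname{Ad})$ holds and $S'$ is non-discrete for each open subnormal subgroup $S$ of $H$. *)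

(* Defs.v *)
From HB Require Import structures.
From mathcomp Require Import all_boot all_order all_algebra.
From mathcomp Require Import all_classical topology normedtype.
From mathcomp Require Import ring.

Set Implicit Arguments.
Unset Strict Implicit.
Unset Printing Implicit Defensive.

Import Order.TTheory GRing.Theory Num.Theory.

Local Open Scope classical_set_scope.
Local Open Scope ring_scope.
Local Open Scope quotient_scope.

(* The p-adic absolute value on the rationals.  Since logn p is constantly 0
   when p is not prime, padic_abs p is then the trivial absolute value; hence
   Q_p below is a field for every p : nat, with no primality argument. *)
Definition padic_abs (p : nat) (x : rat) : rat :=
  if x == 0 then 0
  else p%:R ^ ((logn p `|denq x|)%:Z - (logn p `|numq x|)%:Z).

Section PadicAbs.
Variable p : nat.
Local Notation abs := (padic_abs p).

Lemma padic_abs0 : abs 0 = 0. Proof. by rewrite /padic_abs eqxx. Qed.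

Lemma padic_abs_frac (a b : int) : a != 0 -> b != 0 ->
  abs (a%:~R / b%:~R) = p%:R ^ ((logn p `|b|)%:Z - (logn p `|a|)%:Z).
Proof.
move=> a0 b0; rewrite /padic_abs.
have a0' : (a%:~R : rat) != 0 by rewrite intr_eq0.
have b0' : (b%:~R : rat) != 0 by rewrite intr_eq0.
rewrite mulf_eq0 invr_eq0 (negbTE a0') (negbTE b0') /=.
set x := _ / _; congr (_ ^ _).
have x0 : x != 0 by rewrite mulf_neq0 ?invr_eq0.
have e : numq x * b = a * denq x.
  apply/eqP; rewrite -(eqr_int rat) !intrM; apply/eqP.
  by rewrite numqE /x mulrAC mulfVK.
have /(congr1 absz) := e; rewrite !abszM => /(congr1 (logn p)).
rewrite !lognM ?absz_gt0 ?numq_eq0 ?denq_eq0 // => {}e.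
by apply/eqP; rewrite subr_eq addrAC eq_sym subr_eq -!PoszD addnC e addnC.
Qed.

Lemma padic_abs_gt0 x : x != 0 -> 0 < abs x.
Proof.
move=> x0; rewrite /padic_abs (negbTE x0).
have [pp|npp] := boolP (prime p); first by rewrite exprz_gt0 // ltr0n prime_gt0.
by rewrite /logn (negbTE npp) subrr expr0z.
Qed.

Lemma padic_abs_ge0 x : 0 <= abs x.
Proof.
by have [->|/padic_abs_gt0/ltW//] := eqVneq x 0; rewrite padic_abs0.
Qed.

Lemma padic_abs_eq0 x : (abs x == 0) = (x == 0).
Proof.
by have [->|/padic_abs_gt0/gt_eqF//] := eqVneq x 0; rewrite padic_abs0 eqxx.
Qed.

Lemma padic_absM x y : abs (x * y) = abs x * abs y.
Proof.
have [->|x0] := eqVneq x 0; first by rewrite mul0r padic_abs0 mul0r.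
have [->|y0] := eqVneq y 0; first by rewrite mulr0 padic_abs0 mulr0.
rewrite -[x in LHS]divq_num_den -[y in LHS]divq_num_den mulf_div -!intrM.
rewrite padic_abs_frac ?mulf_neq0 ?numq_eq0 ?denq_eq0 // !abszM.
rewrite !lognM ?absz_gt0 ?numq_eq0 ?denq_eq0 // /padic_abs.
rewrite (negbTE x0) (negbTE y0).
have [pp|npp] := boolP (prime p); last first.
  by rewrite /logn (negbTE npp) !addn0 subrr !expr0z mulr1.
rewrite -expfzDr ?pnatr_eq0 -?lt0n ?prime_gt0 //; congr (_ ^ _).
by rewrite !PoszD opprD addrACA.
Qed.

Lemma padic_abs1 : abs 1 = 1.
Proof.
have := padic_absM 1 1; rewrite mulr1 => /eqP.
rewrite eq_sym -subr_eq0 -{3}[abs 1]mulr1 -mulrBr mulf_eq0 padic_abs_eq0.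
by rewrite oner_eq0 subr_eq0 => /eqP.
Qed.

Lemma padic_absN x : abs (- x) = abs x.
Proof. by rewrite /padic_abs oppr_eq0 numqN denqN abszN. Qed.

Lemma padic_abs_distC x y : abs (x - y) = abs (y - x).
Proof. by rewrite -padic_absN opprB. Qed.

Lemma padic_absV x : abs x^-1 = (abs x)^-1.
Proof.
have [->|x0] := eqVneq x 0; first by rewrite invr0 padic_abs0.
apply: (@mulfI _ (abs x)); first by rewrite padic_abs_eq0.
by rewrite -padic_absM !mulfV ?padic_abs1 // padic_abs_eq0.
Qed.

Lemma padic_abs_le_max x y : abs (x + y) <= Num.max (abs x) (abs y).
Proof.
have [->|x0] := eqVneq x 0.
  by rewrite add0r padic_abs0 le_max lexx orbT.
have [->|y0] := eqVneq y 0.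
  by rewrite addr0 padic_abs0 le_max lexx.
have [->|s0] := eqVneq (x + y) 0.
  by rewrite padic_abs0 le_max !padic_abs_ge0.
have [pp|npp] := boolP (prime p); last first.
  rewrite /padic_abs (negbTE s0) (negbTE x0) (negbTE y0).
  by rewrite /logn (negbTE npp) !subrr !expr0z maxxx.
pose a : int := numq x * denq y; pose b : int := numq y * denq x.
pose d : int := denq x * denq y.
have d0 : d != 0 by rewrite mulf_neq0 ?denq_eq0.
have a0 : a != 0 by rewrite mulf_neq0 ?denq_eq0 ?numq_eq0.
have b0 : b != 0 by rewrite mulf_neq0 ?denq_eq0 ?numq_eq0.
have dx0 : ((denq x)%:~R : rat) != 0 by rewrite intr_eq0 denq_eq0.
have dy0 : ((denq y)%:~R : rat) != 0 by rewrite intr_eq0 denq_eq0.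
have ex : x = a%:~R / d%:~R.
  by rewrite /a /d !intrM -mulf_div mulfV // mulr1 divq_num_den.
have ey : y = b%:~R / d%:~R.
  by rewrite /b /d !intrM [X in _ / X]mulrC -mulf_div mulfV // mulr1 divq_num_den.
have es : x + y = (a + b)%:~R / d%:~R by rewrite ex ey -mulrDl intrD.
have ab0 : a + b != 0.
  by apply: contra s0 => /eqP ab0; rewrite es ab0 mul0r.
rewrite es [in leRHS]ex [in leRHS]ey !padic_abs_frac // le_max.
have p1 : 1 <= p%:R :> rat by rewrite ler1n prime_gt0.
have : (logn p `|a| <= logn p `|(a + b)%R|)%N || (logn p `|b| <= logn p `|(a + b)%R|)%N.
  rewrite -geq_min -pfactor_dvdn ?absz_gt0 //.
  set k := minn _ _.
  have da : ((p ^ k)%:Z %| a)%Z.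
    by rewrite dvdzE pfactor_dvdn ?absz_gt0 // geq_minl.
  have db : ((p ^ k)%:Z %| b)%Z.
    by rewrite dvdzE pfactor_dvdn ?absz_gt0 // geq_minr.
  by have := rpredD da db; rewrite dvdzE.
by case/orP => le; apply/orP; [left|right];
   apply: ler_weXz2l => //; rewrite lerD2l lerN2 lez_nat.
Qed.

End PadicAbs.

Section Completion.
Variable p : nat.
Local Notation abs := (padic_abs p).

Definition padic_cauchy : {pred nat -> rat} := fun u : nat -> rat =>
  `[< forall e : rat, 0 < e -> exists N : nat, forall m n : nat,
      (N <= m)%N -> (N <= n)%N -> abs (u m - u n) < e >].

Lemma padic_cauchyP (u : nat -> rat) : reflect (forall e : rat, 0 < e -> exists N : nat,
    forall m n : nat, (N <= m)%N -> (N <= n)%N -> abs (u m - u n) < e)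
  (u \in padic_cauchy).
Proof. exact: asboolP. Qed.

Definition padic_null (u : nat -> rat) := forall e : rat, 0 < e ->
  exists N : nat, forall n : nat, (N <= n)%N -> abs (u n) < e.

Lemma padic_cauchy_bounded (u : nat -> rat) : u \in padic_cauchy ->
  exists2 M : rat, 0 < M & exists N : nat, forall n : nat, (N <= n)%N -> abs (u n) <= M.
Proof.
move/padic_cauchyP => /(_ _ ltr01)[N cN].
exists (Num.max 1 (abs (u N))); first by rewrite lt_max ltr01.
exists N => n Nn; rewrite -[u n](subrK (u N)).
apply: le_trans (padic_abs_le_max _ _ _) _.
by rewrite ge_max !le_max lexx orbT (ltW (cN _ _ _ _)).
Qed.

Lemma padic_cauchy_subring : GRing.subring_closed padic_cauchy.
Proof.
split.
- apply/padic_cauchyP => e e0; exists 0%N => m n _ _.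
  by rewrite subrr padic_abs0.
- move=> u v /padic_cauchyP cu /padic_cauchyP cv; apply/padic_cauchyP => e e0.
  have [N cN] := cu e e0; have [M cM] := cv e e0.
  exists (maxn N M) => m n; rewrite !geq_max => /andP[Nm Mm] /andP[Nn Mn].
  have -> : (u - v) m - (u - v) n = (u m - u n) + (v n - v m).
    by rewrite opprD opprK addrACA [- v m + _]addrC.
  apply: le_lt_trans (padic_abs_le_max _ _ _) _.
  by rewrite gt_max cN // cM.
- move=> u v cu cv.
  have [A A0 [NA bA]] := padic_cauchy_bounded cu.
  have [B B0 [NB bB]] := padic_cauchy_bounded cv.
  move/padic_cauchyP in cu; move/padic_cauchyP in cv.
  apply/padic_cauchyP => e e0.
  have [N cN] := cu (e / B) (divr_gt0 e0 B0).
  have [M cM] := cv (e / A) (divr_gt0 e0 A0).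
  exists (maxn (maxn N M) (maxn NA NB)) => m n; rewrite !geq_max.
  move=> /andP[/andP[Nm Mm] /andP[Am Bm]] /andP[/andP[Nn Mn] /andP[An Bn]].
  have -> : (u * v) m - (u * v) n = (u m - u n) * v m + u n * (v m - v n).
    by rewrite mulrBl mulrBr addrA subrK.
  apply: le_lt_trans (padic_abs_le_max _ _ _) _.
  rewrite gt_max !padic_absM; apply/andP; split.
    apply: (@le_lt_trans _ _ (abs (u m - u n) * B)).
      by rewrite ler_wpM2l ?padic_abs_ge0 // bB.
    by rewrite -ltr_pdivlMr // cN.
  apply: (@le_lt_trans _ _ (A * abs (v m - v n))).
    by rewrite ler_wpM2r ?padic_abs_ge0 // bA.
  by rewrite mulrC -ltr_pdivlMr // cM.
Qed.

HB.instance Definition _ :=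
  GRing.isSubringClosed.Build (nat -> rat) padic_cauchy padic_cauchy_subring.

Record padic_cseq := PadicCSeq {
  padic_cseq_val :> nat -> rat;
  padic_cseqP : padic_cseq_val \in padic_cauchy }.

HB.instance Definition _ := [isSub for padic_cseq_val].
HB.instance Definition _ := [Choice of padic_cseq by <:].
HB.instance Definition _ := [SubChoice_isSubComNzRing of padic_cseq by <:].

Definition padic_nullseq : {pred padic_cseq} := fun u : padic_cseq => `[< padic_null u >].

Lemma padic_nullseqP (u : padic_cseq) :
  reflect (padic_null u) (u \in padic_nullseq).
Proof. exact: asboolP. Qed.

Lemma padic_nullseq_ideal : idealr_closed padic_nullseq.
Proof.
split.
- by apply/padic_nullseqP => e e0; exists 0%N => n _; rewrite padic_abs0.
- apply/negP => /padic_nullseqP /(_ _ ltr01)[N /(_ N (leqnn N))].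
  by rewrite padic_abs1 ltxx.
- move=> a u v /padic_nullseqP nu /padic_nullseqP nv.
  have [A A0 [NA bA]] := padic_cauchy_bounded (padic_cseqP a).
  apply/padic_nullseqP => e e0.
  have [N cN] := nu (e / A) (divr_gt0 e0 A0); have [M cM] := nv e e0.
  exists (maxn NA (maxn N M)) => n; rewrite !geq_max => /and3P[An Nn Mn].
  apply: le_lt_trans (padic_abs_le_max _ _ _) _.
  rewrite gt_max cM // andbT padic_absM.
  apply: (@le_lt_trans _ _ (A * abs (u n))).
    by rewrite ler_wpM2r ?padic_abs_ge0 // bA.
  by rewrite mulrC -ltr_pdivlMr // cN.
Qed.

HB.instance Definition _ := isIdealr.Build padic_cseq padic_nullseq padic_nullseq_ideal.

Lemma padic_cauchy_lim (u : padic_cseq) : exists r : rat,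
  [/\ 0 <= r, (u \in padic_nullseq) = (r == 0) & forall e : rat, 0 < e ->
    exists N : nat, forall n : nat, (N <= n)%N -> `|abs (u n) - r| < e].
Proof.
have [nu|/padic_nullseqP nnu] := boolP (u \in padic_nullseq).
  exists 0; rewrite eqxx; split=> // e e0; have /padic_nullseqP := nu.
  move=> /(_ e e0)[N cN]; exists N => n Nn.
  by rewrite subr0 ger0_norm ?padic_abs_ge0 // cN.
have [e e0 He] : exists2 e : rat, 0 < e &
    forall N : nat, exists2 n : nat, (N <= n)%N & e <= abs (u n).
  apply: contrapT => H; apply: nnu => e e0; apply: contrapT => H'.
  apply: H; exists e => // N; apply: contrapT => H''; apply: H'; exists N => n Nn.
  by rewrite ltNge; apply/negP => en; apply: H''; exists n.
have /padic_cauchyP/(_ e e0)[N cN] := padic_cseqP u.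
have [k Nk ek] := He N.
exists (abs (u k)).
have uk0 : 0 < abs (u k) by exact: lt_le_trans e0 ek.
split; [exact: padic_abs_ge0 | by rewrite gt_eqF|].
move=> d d0; exists N => n Nn.
suff -> : abs (u n) = abs (u k) by rewrite subrr normr0.
have dn : abs (u n - u k) < abs (u k) by exact: lt_le_trans (cN _ _ Nn Nk) ek.
have le1 : abs (u n) <= abs (u k).
  rewrite -[u n](subrK (u k)); apply: le_trans (padic_abs_le_max _ _ _) _.
  by rewrite ge_max lexx (ltW dn).
apply/eqP; rewrite eq_le le1 /=.
have : abs (u k) <= Num.max (abs (u k - u n)) (abs (u n)).
  by rewrite -[X in abs X <= _](subrK (u n)) padic_abs_le_max.
by rewrite le_max padic_abs_distC leNgt dn.
Qed.

(* Q_p is the completion of the rationals for padic_abs p, i.e. the ring of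
   Cauchy sequences modulo the ideal of null sequences. *)
Definition Qp : Type := {ideal_quot padic_nullseq}.

HB.instance Definition _ := GRing.ComNzRing.on Qp.

Definition Qp_class (u : padic_cseq) : Qp := \pi_({ideal_quot padic_nullseq}) u.
Definition Qp_repr (x : Qp) : padic_cseq := repr (x : {ideal_quot padic_nullseq}).

Lemma Qp_reprK x : Qp_class (Qp_repr x) = x. Proof. exact: reprK. Qed.

Lemma Qp_classE (u v : padic_cseq) :
  (Qp_class u == Qp_class v) = (u - v \in padic_nullseq).
Proof. by rewrite Quotient.idealrBE. Qed.

Lemma Qp_class0 : Qp_class 0 = 0. Proof. exact: (rmorph0 (\pi_({ideal_quot padic_nullseq}))). Qed.
Lemma Qp_class1 : Qp_class 1 = 1. Proof. exact: (rmorph1 (\pi_({ideal_quot padic_nullseq}))). Qed.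
Lemma Qp_classD u v : Qp_class (u + v) = Qp_class u + Qp_class v.
Proof. exact: (rmorphD (\pi_({ideal_quot padic_nullseq}))). Qed.
Lemma Qp_classN u : Qp_class (- u) = - Qp_class u.
Proof. exact: (rmorphN (\pi_({ideal_quot padic_nullseq}))). Qed.
Lemma Qp_classM u v : Qp_class (u * v) = Qp_class u * Qp_class v.
Proof. exact: (rmorphM (\pi_({ideal_quot padic_nullseq}))). Qed.

Lemma padic_cauchyV (u : padic_cseq) : u \notin padic_nullseq ->
  (fun n => (u n)^-1) \in padic_cauchy.
Proof.
have [r [r0 nr lr]] := padic_cauchy_lim u; rewrite nr => rn0.
have {r0 rn0} r0 : 0 < r by rewrite lt_neqAle eq_sym rn0.
have [N cN] := lr (r / 2) (divr_gt0 r0 (ltr0n _ 2)).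
have ub n : (N <= n)%N -> r / 2 < abs (u n).
  move=> /cN; rewrite distrC => /(le_lt_trans (ler_norm _)).
  by rewrite ltrBlDl -ltrBlDr [in X in X - _](splitr r) addrK.
have h0 : 0 < r / 2 by rewrite divr_gt0.
have /padic_cauchyP cu := padic_cseqP u.
apply/padic_cauchyP => e e0; have [M cM] := cu (e * (r / 2) * (r / 2)) (mulr_gt0 (mulr_gt0 e0 h0) h0).
exists (maxn N M) => m n; rewrite !geq_max => /andP[Nm Mm] /andP[Nn Mn].
have um := lt_trans h0 (ub _ Nm); have un := lt_trans h0 (ub _ Nn).
have um0 : u m != 0 by rewrite -(padic_abs_eq0 p) gt_eqF.
have un0 : u n != 0 by rewrite -(padic_abs_eq0 p) gt_eqF.
have -> : (u m)^-1 - (u n)^-1 = (u n - u m) / (u m * u n).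
  by field; rewrite um0 un0.
rewrite padic_absM padic_absV padic_absM ltr_pdivrMr ?mulr_gt0 //.
apply: lt_trans (cM _ _ Mn Mm) _.
by rewrite -mulrA ltr_pM2l // ltr_pM ?ub // ltW.
Qed.

Definition padic_cseq_inv (u : padic_cseq) : padic_cseq :=
  if u \in padic_nullseq =P false is ReflectT h
  then PadicCSeq (padic_cauchyV (negbT h)) else 0.

Definition Qp_inv (x : Qp) : Qp := Qp_class (padic_cseq_inv (Qp_repr x)).

Lemma Qp_eq0 x : (x == 0) = (Qp_repr x \in padic_nullseq).
Proof. by rewrite -{1}(Qp_reprK x) -Qp_class0 Qp_classE subr0. Qed.

Lemma Qp_mulVf (x : Qp) : x != 0 -> Qp_inv x * x = 1.
Proof.
rewrite Qp_eq0 => nx; rewrite -{2}[x]Qp_reprK -Qp_classM -Qp_class1.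
apply/eqP; rewrite Qp_classE; set u := Qp_repr x in nx *.
rewrite /padic_cseq_inv; case: eqP => [h|]; last by rewrite (negbTE nx).
have [r [r0 nr lr]] := padic_cauchy_lim u.
have {r0} r0 : 0 < r by rewrite lt_neqAle r0 eq_sym -nr nx.
have [N cN] := lr r r0.
apply/padic_nullseqP => e e0; exists N => n Nn.
have un0 : u n != 0.
  apply/eqP => un0; have := cN n Nn.
  by rewrite un0 padic_abs0 sub0r normrN gtr0_norm // ltxx.
suff -> : (PadicCSeq (padic_cauchyV (negbT h)) * u - 1 : padic_cseq) n = 0.
  by rewrite padic_abs0.
change ((u n)^-1 * u n - 1 = 0).
by rewrite mulVf // subrr.
Qed.

Lemma Qp_inv0 : Qp_inv 0 = 0.
Proof.
rewrite /Qp_inv /padic_cseq_inv; case: eqP => [h|_]; last exact: Qp_class0.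
by exfalso; have := Qp_eq0 0; rewrite eqxx h.
Qed.

HB.instance Definition _ := GRing.ComNzRing_isField.Build Qp Qp_mulVf Qp_inv0.

(* The extension of padic_abs to Q_p, with values in the rationals: |x| is the
   limit of the absolute values of a sequence representing x.  It cannot be a
   norm in the sense of the library, which requires |x *+ n| = |x| *+ n. *)
Definition Qp_norm (x : Qp) : rat := xget 0 [set r : rat |
  forall e : rat, 0 < e -> exists N : nat, forall n : nat,
    (N <= n)%N -> `|abs (Qp_repr x n) - r| < e].

Lemma Qp_normP (u : padic_cseq) e : 0 < e -> exists N : nat, forall n : nat,
  (N <= n)%N -> `|abs (u n) - Qp_norm (Qp_class u)| < e.
Proof.
move=> e0; rewrite /Qp_norm; set x := Qp_class u.
case: xgetP => [r _ rP|nP]; last first.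
  by have [r [_ _ lr]] := padic_cauchy_lim (Qp_repr x); case: (nP r).
have e20 : 0 < e / 2 by rewrite divr_gt0.
have [N cN] := rP _ e20.
have : u - Qp_repr x \in padic_nullseq by rewrite -Qp_classE Qp_reprK.
move=> /padic_nullseqP /(_ _ e20)[M cM]; exists (maxn N M) => n.
rewrite geq_max => /andP[Nn Mn].
rewrite -(subrK (abs (Qp_repr x n)) (abs (u n))) -addrA.
apply: le_lt_trans (ler_normD _ _) _.
rewrite [e]splitr ltrD ?cN //; apply: le_lt_trans (cM _ Mn).
have tri a b : abs a <= abs (a - b) + abs b.
  rewrite -{1}(subrK b a); apply: le_trans (padic_abs_le_max _ _ _) _.
  by rewrite ge_max lerDl lerDr !padic_abs_ge0.
have -> : (u - Qp_repr x : padic_cseq) n = u n - Qp_repr x n by [].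
rewrite ler_norml lerNl opprB !lerBlDr tri andbT padic_abs_distC.
exact: tri.
Qed.

Lemma Qp_norm_unique (u : padic_cseq) r :
  (forall e, 0 < e -> exists N : nat, forall n : nat,
    (N <= n)%N -> `|abs (u n) - r| < e) -> Qp_norm (Qp_class u) = r.
Proof.
move=> ur; apply/eqP; rewrite -subr_eq0 -normr_le0; apply/ler_addgt0Pl => e e0.
rewrite addr0; have e20 : 0 < e / 2 by rewrite divr_gt0.
have [N cN] := ur _ e20; have [M cM] := Qp_normP u e20.
pose n := maxn N M; rewrite -(subrK (abs (u n)) (Qp_norm _)) -addrA.
apply: le_trans (ler_normD _ _) _; rewrite [e]splitr lerD //.
  by rewrite distrC ltW // cM // leq_maxr.
by rewrite ltW // cN // leq_maxl.
Qed.

Lemma Qp_norm_eq0 x : Qp_norm x = 0 -> x = 0.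
Proof.
move=> x0; apply/eqP; rewrite Qp_eq0; apply/padic_nullseqP => e e0.
have [N cN] := Qp_normP (Qp_repr x) e0; exists N => n Nn.
by have := cN n Nn; rewrite Qp_reprK x0 subr0 ger0_norm ?padic_abs_ge0.
Qed.

Lemma Qp_norm0 : Qp_norm 0 = 0.
Proof.
rewrite -Qp_class0; apply: Qp_norm_unique => e e0; exists 0%N => n _.
by rewrite subr0 [X in abs X](_ : _ = 0) // padic_abs0 normr0.
Qed.

Lemma Qp_normN x : Qp_norm (- x) = Qp_norm x.
Proof.
rewrite -[x]Qp_reprK -Qp_classN; apply: Qp_norm_unique => e e0.
have [N cN] := Qp_normP (Qp_repr x) e0; exists N => n Nn.
by rewrite [X in abs X](_ : _ = - Qp_repr x n) // padic_absN cN.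
Qed.

Lemma Qp_norm_le_max x y : Qp_norm (x + y) <= Num.max (Qp_norm x) (Qp_norm y).
Proof.
rewrite -[x]Qp_reprK -[y]Qp_reprK -Qp_classD.
set u := Qp_repr x; set v := Qp_repr y; set M := Num.max _ _.
apply/ler_addgt0Pl => e e0; have e20 : 0 < e / 2 by rewrite divr_gt0.
have [N1 c1] := Qp_normP u e20; have [N2 c2] := Qp_normP v e20.
have [N3 c3] := Qp_normP (u + v) e20.
pose n := maxn N1 (maxn N2 N3).
have {}c1 : abs (u n) < M + e / 2.
  have := c1 n (leq_maxl _ _); rewrite ltr_distl => /andP[_ /lt_le_trans]; apply.
  by rewrite lerD2r le_max lexx.
have {}c2 : abs (v n) < M + e / 2.
  have n2 : (N2 <= n)%N by rewrite /n maxnCA leq_maxl.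
  have := c2 n n2; rewrite ltr_distl => /andP[_ /lt_le_trans]; apply.
  by rewrite lerD2r le_max lexx orbT.
have n3 : (N3 <= n)%N by rewrite /n maxnA leq_maxr.
have := c3 n n3; rewrite ltr_distl => /andP[+ _]; rewrite ltrBlDr => /ltW/le_trans; apply.
rewrite [in leRHS](splitr e) [in leRHS]addrC addrA lerD2r.
by apply: le_trans (padic_abs_le_max _ _ _) _; rewrite ge_max !ltW.
Qed.

Lemma Qp_norm_ge0 x : 0 <= Qp_norm x.
Proof.
rewrite -[x]Qp_reprK; apply/ler_addgt0Pr => e e0.
have [N cN] := Qp_normP (Qp_repr x) e0.
have := cN N (leqnn N); rewrite ltr_distl => /andP[_ /ltW]; apply: le_trans.
exact: padic_abs_ge0.
Qed.

Definition Qp_dist x y := Qp_norm (x - y).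

Lemma Qp_distxx x : Qp_dist x x = 0.
Proof. by rewrite /Qp_dist subrr Qp_norm0. Qed.

Lemma Qp_dist_eq0 x y : Qp_dist x y = 0 -> x = y.
Proof. by move/Qp_norm_eq0/eqP; rewrite subr_eq0 => /eqP. Qed.

Lemma Qp_dist_sym x y : Qp_dist x y = Qp_dist y x.
Proof. by rewrite /Qp_dist -Qp_normN opprB. Qed.

Lemma Qp_dist_triangle y x z : Qp_dist x z <= Qp_dist x y + Qp_dist y z.
Proof.
rewrite /Qp_dist -[x](subrK y) -addrA addrK.
apply: le_trans (Qp_norm_le_max _ _) _.
by rewrite ge_max lerDl lerDr !Qp_norm_ge0.
Qed.

HB.instance Definition _ := isMetric.Build rat Qp
  Qp_distxx Qp_dist_eq0 Qp_dist_sym Qp_dist_triangle.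

End Completion.

Section Analytic.
Variable p : nat.

Definition vnorm n (v : 'rV[Qp p]_n) : rat :=
  \big[Num.max/0]_(i < n) Qp_norm (v 0 i).

(* f is given near x by a convergent power series.  The growth condition makes
   the family of terms summable for vnorm h < r, so that its sum is the limit
   of the partial sums over the boxes {0, ..., N-1}^n of multi-indices. *)
Definition analytic_at n m (f : 'rV[Qp p]_n -> 'rV[Qp p]_m)
    (x : 'rV[Qp p]_n) : Prop :=
  exists (c : {ffun 'I_n -> nat} -> 'rV[Qp p]_m) (r M : rat),
    [/\ 0 < r,
        forall a, vnorm (c a) * r ^+ (\sum_i a i) <= M
      & forall h : 'rV[Qp p]_n, vnorm h < r ->
          (fun N : nat => \sum_(a : {ffun 'I_n -> 'I_N})
             (\prod_i h 0 i ^+ a i) *: c [ffun i => nat_of_ord (a i)])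
          @ \oo --> f (x + h)].

(* Vectors are rows: A is the derivative of f at x acting as h |-> h *m A. *)
Definition is_derivative n m (f : 'rV[Qp p]_n -> 'rV[Qp p]_m)
    (x : 'rV[Qp p]_n) (A : 'M[Qp p]_(n, m)) : Prop :=
  forall e : rat, 0 < e -> exists2 d : rat, 0 < d &
    forall h : 'rV[Qp p]_n, vnorm h < d ->
      vnorm (f (x + h) - f x - h *m A) <= e * vnorm h.

Definition derivative n m (f : 'rV[Qp p]_n -> 'rV[Qp p]_m)
    (x : 'rV[Qp p]_n) : 'M[Qp p]_(n, m) := xget 0 [set A | is_derivative f x A].

End Analytic.

HB.mixin Record Group_isTopologicalGroup G of Group G & Topological G := {
  mulg_continuous : continuous (fun x : G * G => (x.1 * x.2)%g);
  invg_continuous : continuous (fun x : G => (x^-1)%g)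
}.

#[short(type="topologicalGroupType")]
HB.structure Definition TopologicalGroup :=
  {G of Group G & Topological G & Group_isTopologicalGroup G}.

(* chart_inv is only meaningful on the image of chart_dom. *)
Record chart (p : nat) (X : topologicalType) (n : nat) := Chart {
  chart_dom : set X;
  chart_map :> X -> 'rV[Qp p]_n;
  chart_inv : 'rV[Qp p]_n -> X;
  chart_dom_open : open chart_dom;
  chart_img_open : open (chart_map @` chart_dom);
  chart_mapK : forall x, chart_dom x -> chart_inv (chart_map x) = x;
  chart_map_continuous : {within chart_dom, continuous chart_map};
  chart_inv_continuous : {within chart_map @` chart_dom, continuous chart_inv}
}.

(* A finite-dimensional analytic Lie group over Q_p: the manifold structure is
   given by an analytic atlas of the underlying topological group.  All charts
   have the same dimension, by homogeneity.  Analyticity of the multiplication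
   is expressed in the product charts of G * G, whose coordinates are the
   concatenated vectors row_mx u v. *)
HB.mixin Record isPadicLieGroup (p : nat) G of TopologicalGroup G := {
  lie_dim : nat;
  lie_atlas : set (chart p G lie_dim);
  lie_atlas_cover : forall x : G, exists2 phi, lie_atlas phi & chart_dom phi x;
  lie_atlas_compat : forall phi psi, lie_atlas phi -> lie_atlas psi ->
    forall x : G, chart_dom phi x -> chart_dom psi x ->
    analytic_at (fun u => psi (chart_inv phi u)) (phi x);
  lie_mul_analytic : forall phi1 phi2 psi,
    lie_atlas phi1 -> lie_atlas phi2 -> lie_atlas psi ->
    forall x y : G, chart_dom phi1 x -> chart_dom phi2 y ->
    chart_dom psi (x * y)%g ->
    analytic_at
      (fun w => psi (chart_inv phi1 (lsubmx w) * chart_inv phi2 (rsubmx w))%g)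
      (row_mx (phi1 x) (phi2 y));
  lie_inv_analytic : forall phi psi, lie_atlas phi -> lie_atlas psi ->
    forall x : G, chart_dom phi x -> chart_dom psi (x^-1)%g ->
    analytic_at (fun u => psi ((chart_inv phi u)^-1)%g) (phi x)
}.

#[short(type="padicLieGroupType")]
HB.structure Definition PadicLieGroup (p : nat) :=
  {G of TopologicalGroup G & isPadicLieGroup p G}.

Section Adjoint.
Variables (p : nat) (G : padicLieGroupType p).

(* Tangent vectors at 1 are classes, for tangent_eq, of coordinate vectors in
   a chart around 1; these classes form the Lie algebra of G. *)
Record tangent1 := Tangent1 {
  tangent_chart : chart p G (@lie_dim p G);
  tangent_chart_atlas : @lie_atlas p G tangent_chart;
  tangent_chart_dom1 : chart_dom tangent_chart 1%g;
  tangent_coord : 'rV[Qp p]_(@lie_dim p G)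
}.

Definition tangent_eq (X Y : tangent1) : Prop :=
  let phi := tangent_chart X in let psi := tangent_chart Y in
  tangent_coord Y =
    tangent_coord X *m derivative (fun u => psi (chart_inv phi u)) (phi 1%g).

(* The tangent map at 1 of a map f from G to G with f 1 = 1. *)
Definition tangent_map1 (f : G -> G) (X : tangent1) : tangent1 :=
  let phi := tangent_chart X in
  @Tangent1 phi (tangent_chart_atlas X) (tangent_chart_dom1 X)
    (tangent_coord X *m
       derivative (fun u => phi (f (chart_inv phi u))) (phi 1%g)).

Definition Ad (g : G) : tangent1 -> tangent1 :=
  tangent_map1 (fun x => g * x * g^-1)%g.

Definition ker_Ad : set G := [set g | forall X, tangent_eq (Ad g X) X].

End Adjoint.

Section Subgroups.
Variable G : topologicalGroupType.
Implicit Types S N K Z : set G.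

Definition is_subgroup S : Prop :=
  S 1%g /\ forall x y, S x -> S y -> S (x * y^-1)%g.

Definition normal_in N K : Prop :=
  [/\ is_subgroup N, is_subgroup K, N `<=` K &
      forall k n, K k -> N n -> N (k * n * k^-1)%g].

Definition subnormal S : Prop :=
  exists (m : nat) (C : nat -> set G),
    [/\ C 0%N = setT, C m = S &
        forall i : nat, (i < m)%N -> normal_in (C i.+1) (C i)].

Definition abelian_set S : Prop :=
  forall x y, S x -> S y -> (x * y = y * x)%g.

Definition commutator_group S : set G :=
  smallest is_subgroup
    [set (x.1 * x.2 * x.1^-1 * x.2^-1)%g | x in S `*` S].

Definition discrete_set S : Prop := forall x, S x -> isolated S x.

(* K / Z is discrete: every subset of K / Z is open for the quotient topology,
   i.e. every union of cosets of Z in K is open in K. *)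
Definition discrete_quotient K Z : Prop :=
  forall A : set G, A `<=` K ->
    (forall a z, A a -> Z z -> A (a * z)%g) ->
    exists2 U : set G, open U & A = U `&` K.

(* Continuity into the space of matrices is continuity into GL_d(Q_p), whose
   topology is the induced one. *)
Definition continuous_GL_hom (p d : nat) (beta : G -> 'M[Qp p]_d) : Prop :=
  [/\ continuous beta, forall g, beta g \in unitmx &
      forall g h, beta (g * h)%g = beta g *m beta h].

End Subgroups.

Definition nearly_simple (p : nat) (H : padicLieGroupType p) : Prop :=
  forall S : set H, closed S -> subnormal S -> open S \/ discrete_set S.

Definition extraordinary (p : nat) (H : padicLieGroupType p) : Prop :=
  [/\ nearly_simple H, @ker_Ad p H = setT &
      forall S : set H, open S -> subnormal S ->
        ~ discrete_set (commutator_group S)].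

(* Main.v *)
Require Import Defs.
From mathcomp Require Import all_boot all_order all_algebra.
From mathcomp Require Import all_classical topology normedtype.
From mathcomp Require Import ring.

Set Implicit Arguments.
Unset Strict Implicit.
Unset Printing Implicit Defensive.

Import Order.TTheory GRing.Theory Num.Theory.

Local Open Scope classical_set_scope.
Local Open Scope ring_scope.

(* Let H be extraordinary, and take Z, K = ker beta as in the hypothesis.  Since
   Z' is trivial, Z cannot be open, so Z is discrete, and hence so is K.
   An element h of ker Ad centralises a neighbourhood of 1: in a chart at 1 the
   p-th power map multiplies distances by |p|, because multiplication is
   strictly differentiable with derivative (u, v) |-> u + v.  It commutes with
   conjugation by h, whose derivative at 1 is the identity; so
   |h x h^-1 - x| = |p|^-n |h x^(p^n) h^-1 - x^(p^n)| <= e |x| for every e > 0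
   and n large.
   This neighbourhood depends on h, but a subspace of matrices of minimal
   dimension among those containing beta(U) for some neighbourhood U of 1 lies
   in the commutant of every beta(h).  Hence the elements whose image is central
   in beta(H) form an open normal subgroup V with V' contained in K, so V' is
   discrete, which is a contradiction. *)

(** * The norm of Q_p^n *)

Lemma Qp_normM p (x y : Qp p) : Qp_norm (x * y) = Qp_norm x * Qp_norm y.
Proof.
rewrite -[x]Qp_reprK -[y]Qp_reprK -Qp_classM.
set u := Qp_repr x; set v := Qp_repr y; apply: Qp_norm_unique => e e0.
set r := Qp_norm (Qp_class u); set s := Qp_norm (Qp_class v).
have r0 : 0 <= r by exact: Qp_norm_ge0.
have s0 : 0 <= s by exact: Qp_norm_ge0.
have [M1 c1] := Qp_normP v ltr01.
(* The [+ 1] keeps the denominators positive when a norm vanishes, and [s + 1] also bounds the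
   absolute values of [v n] for large [n]. *)
have a0 : 0 < e / 2 / (s + 1) by rewrite !divr_gt0 // ltr_wpDl.
have b0 : 0 < e / 2 / (r + 1) by rewrite !divr_gt0 // ltr_wpDl.
have [M2 c2] := Qp_normP u a0; have [M3 c3] := Qp_normP v b0.
exists (maxn M1 (maxn M2 M3)) => n; rewrite !geq_max => /and3P[h1 h2 h3].
rewrite [X in padic_abs p X](_ : _ = u n * v n) // padic_absM.
set a := padic_abs p (u n); set b := padic_abs p (v n).
have -> : a * b - r * s = (a - r) * b + r * (b - s).
  by rewrite mulrBl mulrBr addrA subrK.
apply: le_lt_trans (ler_normD _ _) _.
have b1 : `|b| <= s + 1.
  rewrite ger0_norm ?padic_abs_ge0 //.
  by have := c1 n h1; rewrite ltr_distl => /andP[_ /ltW].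
rewrite !normrM (ger0_norm r0) [e]splitr; apply: ltr_leD.
  apply: (@le_lt_trans _ _ (`|a - r| * (s + 1))); first by rewrite ler_wpM2l.
  by rewrite -ltr_pdivlMr ?ltr_wpDl // c2.
apply: (@le_trans _ _ ((r + 1) * `|b - s|)); first by rewrite ler_wpM2r // lerDl.
by rewrite mulrC -ler_pdivlMr ?ltr_wpDl // ltW // c3.
Qed.

Lemma Qp_norm1 p : Qp_norm (1 : Qp p) = 1.
Proof.
rewrite -Qp_class1; apply: Qp_norm_unique => e e0; exists 0%N => n _.
by rewrite [X in padic_abs p X](_ : _ = 1) // padic_abs1 subrr normr0.
Qed.

Lemma Qp_norm_natr_le1 p n : Qp_norm (n%:R : Qp p) <= 1.
Proof.
elim: n => [|n IH]; first by rewrite Qp_norm0.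
rewrite mulrSr; apply: le_trans (Qp_norm_le_max _ _) _.
by rewrite ge_max IH Qp_norm1 lexx.
Qed.

(** Primality enters through [logn p p = 1]. That this value is below 1 makes the p-th power map a
    contraction later on. *)
Lemma Qp_norm_p p : prime p -> Qp_norm (p%:R : Qp p) = p%:R^-1.
Proof.
move=> pp; have classR n : (n%:R : Qp p) = Qp_class (n%:R : padic_cseq p).
  elim: n => [|n IH]; first by rewrite Qp_class0.
  by rewrite !mulrSr Qp_classD IH Qp_class1.
rewrite classR.
apply: Qp_norm_unique => e e0; exists 0%N => n _.
have -> : (p%:R : padic_cseq p) n = p%:R.
  have H m : (m%:R : padic_cseq p) n = m%:R; last exact: H.
  by elim: m => [|m IH] //; rewrite !mulrSr -IH.
have p0 : (p%:Z : int) != 0 by rewrite eqz_nat -lt0n prime_gt0.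
have := @padic_abs_frac p p%:Z 1 p0 isT.
rewrite divr1 /= => ->; rewrite logn1 lognE pp (prime_gt0 pp) dvdnn /=.
by rewrite divnn (prime_gt0 pp) logn1 subrr normr0.
Qed.

Lemma vnorm_ge0 p n (v : 'rV[Qp p]_n) : 0 <= vnorm v.
Proof. exact: bigmax_ge_id. Qed.

Lemma vnorm_leP p n (v : 'rV[Qp p]_n) (e : rat) : 0 <= e ->
  reflect (forall i, Qp_norm (v 0 i) <= e) (vnorm v <= e).
Proof.
move=> e0; apply: (iffP idP) => [h i|h]; last by apply/bigmax_leP; split.
by apply: le_trans h; exact: le_bigmax.
Qed.

Lemma vnorm_ltP p n (v : 'rV[Qp p]_n) (e : rat) : 0 < e ->
  reflect (forall i, Qp_norm (v 0 i) < e) (vnorm v < e).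
Proof.
move=> e0; apply: (iffP idP) => [h i|h]; last by apply/bigmax_ltP; split.
by apply: le_lt_trans h; exact: le_bigmax.
Qed.

Lemma Qp_norm_coord_le p n (v : 'rV[Qp p]_n) i : Qp_norm (v 0 i) <= vnorm v.
Proof. exact: le_bigmax. Qed.

Lemma vnorm0 p n : vnorm (0 : 'rV[Qp p]_n) = 0.
Proof.
by apply/le_anti; rewrite vnorm_ge0 andbT; apply/vnorm_leP => // i; rewrite mxE Qp_norm0.
Qed.

Lemma vnorm_eq0 p n (v : 'rV[Qp p]_n) : vnorm v = 0 -> v = 0.
Proof.
move=> v0; apply/rowP => i; rewrite mxE; apply: Qp_norm_eq0; apply/le_anti.
by rewrite Qp_norm_ge0 -v0 Qp_norm_coord_le.
Qed.

Lemma vnorm_le_max p n (u v : 'rV[Qp p]_n) :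
  vnorm (u + v) <= Num.max (vnorm u) (vnorm v).
Proof.
apply/vnorm_leP => [|i]; first by rewrite le_max vnorm_ge0.
rewrite mxE; apply: le_trans (Qp_norm_le_max _ _) _.
by rewrite ge_max !le_max !Qp_norm_coord_le orbT.
Qed.

Lemma vnormD_le p n (u v : 'rV[Qp p]_n) e :
  vnorm u <= e -> vnorm v <= e -> vnorm (u + v) <= e.
Proof. by move=> ue ve; apply: le_trans (vnorm_le_max _ _) _; rewrite ge_max ue. Qed.

Lemma vnormN p n (v : 'rV[Qp p]_n) : vnorm (- v) = vnorm v.
Proof. by apply: eq_bigr => i _; rewrite mxE Qp_normN. Qed.

Lemma vnormB_le p n (u v : 'rV[Qp p]_n) e :
  vnorm u <= e -> vnorm v <= e -> vnorm (u - v) <= e.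
Proof. by move=> ue ve; rewrite vnormD_le ?vnormN. Qed.

Lemma vnorm_distC p n (u v : 'rV[Qp p]_n) : vnorm (u - v) = vnorm (v - u).
Proof. by rewrite -vnormN opprB. Qed.

Lemma vnorm_sum p n (I : finType) (P : pred I) (F : I -> 'rV[Qp p]_n) e : 0 <= e ->
  (forall i, P i -> vnorm (F i) <= e) -> vnorm (\sum_(i | P i) F i) <= e.
Proof.
move=> e0 Fe; elim/big_ind: _ => //; first by rewrite vnorm0.
by move=> u v; exact: vnormD_le.
Qed.

Lemma vnormZ p n a (v : 'rV[Qp p]_n) : vnorm (a *: v) = Qp_norm a * vnorm v.
Proof.
rewrite /vnorm; elim/big_ind2: _ => [|x1 x2 y1 y2 -> ->|i _]; first by rewrite mulr0.
  by rewrite maxr_pMr // Qp_norm_ge0.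
by rewrite mxE Qp_normM.
Qed.

(** If [u] were shorter than [v], then [v = (v - u) + u] would be a sum of two vectors both shorter
    than [v], against the ultrametric inequality. *)
Lemma vnorm_isosceles p n (u v : 'rV[Qp p]_n) e :
  vnorm (u - v) <= e -> e < vnorm v -> vnorm u = vnorm v.
Proof.
move=> uv ev; apply/le_anti/andP; split.
  by rewrite -[u](subrK v) vnormD_le // (le_trans uv) // ltW.
rewrite leNgt; apply/negP => uv'; have := vnorm_le_max (v - u) u.
by rewrite subrK le_max vnorm_distC leNgt (le_lt_trans uv ev) /= leNgt uv'.
Qed.

(** Meant for multiplication in a chart: [w] is the increment of a product, [u] and [v] those of its
    factors, [a] and [b] the values of the derivative on them. The ultrametric inequality lets
    [u + v] replace [a + b] without enlarging [e]. *)
Lemma vnorm_additive_approx p n (w u v a b : 'rV[Qp p]_n) e : 0 <= e ->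
  vnorm (u - a) <= e * vnorm u -> vnorm (v - b) <= e * vnorm v ->
  vnorm (w - (a + b)) <= e * Num.max (vnorm u) (vnorm v) ->
  vnorm (w - u - v) <= e * Num.max (vnorm u) (vnorm v).
Proof.
move=> e0 ua vb wab.
have -> : w - u - v = (w - (a + b)) - ((u - a) + (v - b)).
  by apply/rowP => i; rewrite !mxE; ring.
apply: (vnormB_le wab); apply: vnormD_le.
  by apply: le_trans ua _; apply: ler_wpM2l e0 _ _ _; rewrite le_max lexx.
by apply: le_trans vb _; apply: ler_wpM2l e0 _ _ _; rewrite le_max lexx orbT.
Qed.

Lemma vnorm_le_of_additive_approx p n (w u v : 'rV[Qp p]_n) e : e <= 1 ->
  vnorm (w - u - v) <= e * Num.max (vnorm u) (vnorm v) ->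
  vnorm w <= Num.max (vnorm u) (vnorm v).
Proof.
move=> e1 H.
have -> : w = (w - u - v) + (u + v) by rewrite -[w - u - v]addrA -opprD subrK.
apply: vnormD_le (vnorm_le_max _ _); apply: le_trans H _.
by rewrite ler_piMl // le_max vnorm_ge0.
Qed.

(** Induction step for powers: [u], [v], [w] stand for the differences of first, k-th and (k+1)-st
    powers. The error does not grow with [k], since integers have norm at most 1 and so [v] is no
    longer than [u]. *)
Lemma vnorm_multiple_approx_succ p n (w u v : 'rV[Qp p]_n) e k : 0 <= e <= 1 ->
  vnorm (w - u - v) <= e * Num.max (vnorm u) (vnorm v) ->
  vnorm (v - k%:R *: u) <= e * vnorm u ->
  vnorm (w - k.+1%:R *: u) <= e * vnorm u.
Proof.
move=> /andP[e0 e1] Hw Hv.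
have -> : w - k.+1%:R *: u = (w - u - v) + (v - k%:R *: u).
  by apply/rowP => i; rewrite !mxE mulrSr; ring.
apply: (vnormD_le _ Hv); apply: le_trans Hw _; rewrite ler_wpM2l //.
rewrite ge_max lexx -[v](subrK (k%:R *: u)); apply: vnormD_le.
  by apply: le_trans Hv _; rewrite ler_piMl ?vnorm_ge0.
by rewrite vnormZ ler_piMl ?vnorm_ge0 ?Qp_norm_natr_le1.
Qed.

Lemma vnorm_scale_approx p n (w u : 'rV[Qp p]_n) a e : e < Qp_norm a ->
  vnorm (w - a *: u) <= e * vnorm u -> vnorm w = Qp_norm a * vnorm u.
Proof.
(* The isosceles argument needs the strict inequality [e * vnorm u < Qp_norm a * vnorm u], which
   fails for [u = 0]. *)
move=> ea H; have [u0|u_neq0] := eqVneq (vnorm u) 0.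
  move: H; rewrite (vnorm_eq0 u0) scaler0 subr0 vnorm0 !mulr0 => H.
  by apply/le_anti; rewrite H vnorm_ge0.
have u_gt0 : 0 < vnorm u by rewrite lt_neqAle eq_sym u_neq0 vnorm_ge0.
by rewrite (vnorm_isosceles H) vnormZ // ltr_pM2r.
Qed.

Lemma vnorm_row_mx_le p n m (u : 'rV[Qp p]_n) (v : 'rV[Qp p]_m) :
  vnorm (row_mx u v) <= Num.max (vnorm u) (vnorm v).
Proof.
apply/vnorm_leP => [|i]; first by rewrite le_max vnorm_ge0.
by rewrite mxE le_max; case: splitP => j _; rewrite Qp_norm_coord_le ?orbT.
Qed.

Lemma vnorm_row_mx_lt p n m (u : 'rV[Qp p]_n) (v : 'rV[Qp p]_m) (e : rat) :
  vnorm u < e -> vnorm v < e -> vnorm (row_mx u v) < e.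
Proof.
by move=> ue ve; apply: le_lt_trans (vnorm_row_mx_le _ _) _; rewrite gt_max ue.
Qed.

Lemma vnorm_mulmx_bound p n m (A : 'M[Qp p]_(n, m)) :
  exists2 C : rat, 0 < C & forall h, vnorm (h *m A) <= C * vnorm h.
Proof.
pose C : rat := 1 + \sum_i vnorm (row i A).
have C0 : 0 < C by rewrite ltr_pwDl // sumr_ge0 // => i _; exact: vnorm_ge0.
exists C => // h; rewrite mulmx_sum_row; apply: vnorm_sum => [|i _].
  by rewrite mulr_ge0 ?vnorm_ge0 // ltW.
rewrite vnormZ mulrC ler_pM ?vnorm_ge0 ?Qp_norm_ge0 ?Qp_norm_coord_le //.
rewrite /C (bigD1 i) //= addrCA lerDl addr_ge0 // sumr_ge0 // => j _.
exact: vnorm_ge0.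
Qed.

Lemma ball_vnorm p n (x y : 'rV[Qp p]_n) e : 0 < e -> ball x e y <-> vnorm (y - x) < e.
Proof.
move=> e0; split.
  move=> [_ h]; apply/vnorm_ltP => // i; have := h 0 i.
  by rewrite ballEmdist /= metric_sym /mdist /= /Qp_dist !mxE.
move=> /vnorm_ltP h; split=> // i j; have := h e0 j.
by rewrite !mxE ballEmdist /= metric_sym /mdist /= /Qp_dist (ord1 i).
Qed.

Lemma nbhs_vnormP p n (x : 'rV[Qp p]_n) (A : set 'rV[Qp p]_n) :
  nbhs x A <-> exists2 e : rat, 0 < e & forall h, vnorm h < e -> A (x + h).
Proof.
split=> [/nbhs_ballP[e /= e0 he]|[e e0 he]].
  exists e => // h hh; apply: he; apply/ball_vnorm => //.
  by rewrite addrAC subrr add0r.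
apply/nbhs_ballP; exists e => //= y /(ball_vnorm _ _ e0) /he.
by rewrite addrCA subrr addr0.
Qed.

Lemma cvg_vnorm p n (f : nat -> 'rV[Qp p]_n) (l : 'rV[Qp p]_n) (e : rat) : f @ \oo --> l -> 0 < e ->
  exists N, forall k, (N <= k)%N -> vnorm (f k - l) < e.
Proof.
move=> /cvg_ballP fl e0; have [N _ hN] := fl e e0.
by exists N => k Nk; apply/ball_vnorm => //; exact: hN.
Qed.

(** * Strict differentiability of analytic maps *)

(** The bounds collected in [K] pass to products by the identity xx' - yy' = (x - y)x' + y(x' - y').
    The factor [d] on the left avoids the exponent [\sum_i a i - 1], which would be truncated in
    degree 0. *)
Lemma monomial_lipschitz p n (h h' : 'rV[Qp p]_n) (a : 'I_n -> nat) (d : rat) :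
  vnorm h <= d -> vnorm h' <= d ->
  d * Qp_norm (\prod_i h 0 i ^+ a i - \prod_i h' 0 i ^+ a i)
    <= vnorm (h - h') * d ^+ (\sum_i a i).
Proof.
move=> hd hd'; have d0 := le_trans (vnorm_ge0 h) hd.
have D0 := vnorm_ge0 (h - h').
pose K (x y : Qp p) k := [/\ Qp_norm x <= d ^+ k, Qp_norm y <= d ^+ k
  & d * Qp_norm (x - y) <= vnorm (h - h') * d ^+ k].
have K1 : K 1 1 0%N.
  by split; rewrite ?Qp_norm1 ?expr0 // subrr Qp_norm0 mulr0 mulr1.
have KM x y k x' y' k' : K x y k -> K x' y' k' -> K (x * x') (y * y') (k + k')%N.
  move=> [xk yk xyk] [xk' yk' xyk']; split.
  - by rewrite Qp_normM exprD ler_pM ?Qp_norm_ge0.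
  - by rewrite Qp_normM exprD ler_pM ?Qp_norm_ge0.
  have -> : x * x' - y * y' = (x - y) * x' + y * (x' - y').
    by rewrite mulrBl mulrBr addrA subrK.
  apply: le_trans (ler_wpM2l d0 (Qp_norm_le_max _ _)) _.
  rewrite maxr_pMr // ge_max !Qp_normM exprD; apply/andP; split.
    by rewrite !mulrA ler_pM ?mulr_ge0 ?Qp_norm_ge0.
  rewrite [leLHS]mulrCA [leRHS]mulrCA.
  by rewrite ler_pM ?mulr_ge0 ?Qp_norm_ge0.
have Kh i : K (h 0 i) (h' 0 i) 1%N.
  split; rewrite ?expr1 ?(le_trans (Qp_norm_coord_le _ _)) // mulrC ler_wpM2r //.
  by have := Qp_norm_coord_le (h - h') i; rewrite !mxE.
have KX i k : K (h 0 i ^+ k) (h' 0 i ^+ k) k.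
  by elim: k => [|k IH] //; rewrite !exprS; exact: (KM _ _ 1%N).
suff [] : K (\prod_i h 0 i ^+ a i) (\prod_i h' 0 i ^+ a i) (\sum_i a i)%N by [].
by elim/big_ind3: _ => // x y k x' y' k'; exact: KM.
Qed.

(** The rows of [A] are the degree-one coefficients. In a difference of two values the constant term
    cancels, and the terms of degree at least 2 are small relative to [h - h']. *)
Lemma analytic_strict_derivative p n m (f : 'rV[Qp p]_n -> 'rV[Qp p]_m) x :
  analytic_at f x -> exists A : 'M[Qp p]_(n, m), forall e : rat, 0 < e ->
    exists2 d : rat, 0 < d & forall h h', vnorm h < d -> vnorm h' < d ->
      vnorm (f (x + h) - f (x + h') - (h - h') *m A) <= e * vnorm (h - h').
Proof.
move=> [c [r [M [r0 cM cf]]]].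
pose unit_idx i : {ffun 'I_n -> nat} := [ffun j => (j == i : nat)].
exists (\matrix_i c (unit_idx i)) => e e0.
have M0 : 0 <= M.
  by apply: le_trans (cM [ffun=> 0%N]); rewrite mulr_ge0 ?vnorm_ge0 // exprn_ge0 // ltW.
(* Chosen so that [d * M <= e * r ^+ 2], which absorbs all terms of degree at least 2; the [+ 1]
   covers [M = 0]. *)
pose d := Num.min r (e * r ^+ 2 / (M + 1)).
have M1 : 0 < M + 1 by rewrite ltr_wpDl.
have d0 : 0 < d by rewrite lt_min r0 divr_gt0 // mulr_gt0 // exprn_gt0.
have dr : d <= r by rewrite ge_min lexx.
have dM : d * M <= e * r ^+ 2.
  apply: (@le_trans _ _ (d * (M + 1))); first by rewrite ler_wpM2l ?lerDl // ltW.
  by rewrite -ler_pdivlMr // ge_min lexx orbT.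
exists d => // h h' hd hd'; set D := vnorm (h - h').
have D0 : 0 <= D := vnorm_ge0 _.
pose t (v : 'rV[Qp p]_n) N (a : {ffun 'I_n -> 'I_N}) : 'rV[Qp p]_m :=
  (\prod_i v 0 i ^+ a i) *: c [ffun i => nat_of_ord (a i)].
(* Boxes of side [N.+2] contain the exponents 0 and 1, so each degree-one multi-index [u i]
   occurs. *)
have main N : vnorm (\sum_a t h N.+2 a - \sum_a t h' N.+2 a
    - (h - h') *m (\matrix_i c (unit_idx i))) <= e * D.
  pose u i : {ffun 'I_n -> 'I_N.+2} := [ffun j => inord (j == i)].
  have uE i j : u i j = (j == i) :> nat by rewrite ffunE inordK //; case: (j == i).
  have u_inj : injective u.
    move=> i j /(congr1 (fun g : {ffun _} => nat_of_ord (g i))).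
    by rewrite !uE eqxx; case: eqP.
  (* The terms indexed by the image of [u] cancel exactly against the linear part. *)
  rewrite -sumrB (bigID (mem [set u i | i in 'I_n]%SET)) /=.
  rewrite big_imset /=; last by move=> i j _ _; exact: u_inj.
  rewrite mulmx_sum_row addrAC (_ : _ - _ = 0) ?add0r; last first.
    apply/eqP; rewrite subr_eq0; apply/eqP/eq_bigr => i _.
    have tE v : t v N.+2 (u i) = v 0 i *: c (unit_idx i).
      rewrite /t; congr (_ *: c _); last by apply/ffunP => j; rewrite ffunE uE ffunE.
      rewrite (bigD1 i) //= uE eqxx expr1 big1 ?mulr1 // => j ji.
      by rewrite uE (negbTE ji) expr0.
    by rewrite !tE -scalerBl rowK !mxE.
  apply: vnorm_sum => [|a au]; first by rewrite mulr_ge0 // ltW.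
  rewrite /t -scalerBl vnormZ.
  set w := vnorm _; set q := Qp_norm _.
  have qd : d * q <= D * d ^+ (\sum_i a i).
    by apply: monomial_lipschitz; exact: ltW.
  have wM : w * r ^+ (\sum_i a i) <= M.
    by have := cM [ffun i => nat_of_ord (a i)]; under eq_bigr do rewrite ffunE.
  have w0 : 0 <= w := vnorm_ge0 _.
  have q0 : 0 <= q := Qp_norm_ge0 _.
  have [a0|a_gt0] := posnP (\sum_i a i)%N.
    rewrite (_ : q = 0) ?mul0r ?mulr_ge0 ?(ltW e0) //.
    move/eqP: a0; rewrite sum_nat_eq0 => /forallP a0.
    rewrite /q !big1 ?subrr ?Qp_norm0 // => i _; by rewrite (eqP (a0 i)) expr0.
  have [a1|a_neq1] := eqVneq (\sum_i a i)%N 1%N.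
    case/negP: au; move/eqP/sum_nat_eq1: a1 => [i [_ ai aj]].
    apply/imsetP; exists i => //; apply/ffunP => j; apply/val_inj; rewrite /= uE.
    by case: eqVneq => [->|/aj ->]; rewrite ?ai.
  (* In degree k + 2 the term is at most D d^(k+1) w; with d <= r and w r^(k+2) <= M this is at most
     D d M / r^2 <= e D. *)
  have [k ak] : exists k, (\sum_i a i = k.+2)%N.
    exists (\sum_i a i).-2%N.
    by case: (\sum_i a i)%N a_gt0 a_neq1 => [|[|]].
  rewrite ak in qd wM.
  have qd' : q <= D * d ^+ k.+1.
    by rewrite -(ler_pM2l d0) mulrCA -exprS.
  have h1 : q * w <= D * d ^+ k.+1 * w by rewrite ler_wpM2r.
  apply: le_trans h1 _; rewrite -mulrA [e * D]mulrC; apply: ler_wpM2l => //.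
  have r2 : 0 < r ^+ 2 by rewrite exprn_gt0.
  rewrite -(ler_pM2r r2); apply: le_trans dM.
  rewrite exprS -!mulrA; apply: ler_wpM2l; first exact: ltW.
  apply: le_trans wM; rewrite mulrCA; apply: ler_wpM2l => //.
  rewrite -[k.+2]addn2 exprD; apply: ler_wpM2r; first exact: ltW.
  by rewrite lerXn2r // nnegrE ltW.
(* The bound holds for all box sums; it passes to their limits up to an arbitrary [eps]. *)
apply/ler_addgt0Pl => eps eps0.
have [N1 H1] := cvg_vnorm (cf h (lt_le_trans hd dr)) eps0.
have [N2 H2] := cvg_vnorm (cf h' (lt_le_trans hd' dr)) eps0.
pose N := maxn N1 N2.
have {}H1 : vnorm (\sum_a t h N.+2 a - f (x + h)) < eps.
  by apply: H1; rewrite 2?leqW // leq_maxl.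
have {}H2 : vnorm (\sum_a t h' N.+2 a - f (x + h')) < eps.
  by apply: H2; rewrite 2?leqW // leq_maxr.
have eD : 0 <= e * D by rewrite mulr_ge0 // ltW.
set S := \sum_a t h N.+2 a in H1; set S' := \sum_a t h' N.+2 a in H2.
set B := _ *m _.
have -> : f (x + h) - f (x + h') - B
    = (S - S' - B) - ((S - f (x + h)) - (S' - f (x + h'))).
  set F := f _; set F' := f _; apply/rowP => i; rewrite !mxE; ring.
apply: vnormB_le; first by apply: le_trans (main N) _; rewrite lerDr ltW.
exact: vnormB_le (ltW (ltr_wpDr eD H1)) (ltW (ltr_wpDr eD H2)).
Qed.

(** * Multiplication and powers in a chart at the identity *)

Local Opaque vnorm Qp_norm.

Definition chart_ball p (X : topologicalType) n (phi : chart p X n) (x : X) (d : rat) : set X :=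
  [set y | chart_dom phi y /\ vnorm (phi y - phi x) < d].

Lemma chart_ball_center p (X : topologicalType) n (phi : chart p X n) x d :
  chart_dom phi x -> 0 < d -> chart_ball phi x d x.
Proof. by move=> phix d0; split=> //; rewrite subrr vnorm0. Qed.

Lemma chart_ball_le p (X : topologicalType) n (phi : chart p X n) x d d' :
  d <= d' -> chart_ball phi x d `<=` chart_ball phi x d'.
Proof. by move=> dd' y [phiy yd]; split=> //; exact: lt_le_trans dd'. Qed.

Lemma nbhs_chart_ball p (X : topologicalType) n (phi : chart p X n) x d :
  chart_dom phi x -> 0 < d -> nbhs x (chart_ball phi x d).
Proof.
move=> phix d0; apply: filterI; first by apply: open_nbhs_nbhs; split; first exact: chart_dom_open.
have := @chart_map_continuous _ _ _ phi.
rewrite continuous_open_subspace; last exact: chart_dom_open.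
move=> /(_ x (mem_set phix)) phi_cont.
have : nbhs (phi x) [set u | vnorm (u - phi x) < d].
  by apply/nbhs_vnormP; exists d => // h hd; rewrite /= addrAC subrr add0r.
by move/phi_cont.
Qed.

Lemma chart_ball_sub p (X : topologicalType) n (phi : chart p X n) x (A : set X) :
  chart_dom phi x -> nbhs x A -> exists2 d : rat, 0 < d & chart_ball phi x d `<=` A.
Proof.
move=> phix Ax; have := @chart_inv_continuous _ _ _ phi.
rewrite continuous_open_subspace; last exact: chart_img_open.
have /[swap] /[apply] : phi x \in phi @` chart_dom phi by rewrite inE; exists x.
rewrite /continuous_at chart_mapK // => /(_ A Ax) /nbhs_vnormP[d d0 Ad].
by exists d => // y [phiy /Ad]; rewrite /= addrCA subrr addr0 chart_mapK.
Qed.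

(** The derivative [A] at (1, 1) is never computed. When one pair of factors is 1, the product is
    the other factor, so the strict estimate itself says that [A] is nearly the identity on each
    block. *)
Lemma chart_mulg_strict p (G : padicLieGroupType p) (phi : chart p G (@lie_dim p G)) (e : rat) :
  @lie_atlas p G phi -> chart_dom phi 1%g -> 0 < e ->
  exists2 d : rat, 0 < d & forall g g' h h',
    chart_ball phi 1%g d g -> chart_ball phi 1%g d g' ->
    chart_ball phi 1%g d h -> chart_ball phi 1%g d h' ->
    chart_dom phi (g * h)%g /\
    vnorm (phi (g * h)%g - phi (g' * h')%g - (phi g - phi g') - (phi h - phi h'))
      <= e * Num.max (vnorm (phi g - phi g')) (vnorm (phi h - phi h')).
Proof.
move=> phiA phi1 e0.
have dom11 : chart_dom phi (1 * 1)%g by rewrite mulg1.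
have [A /(_ e e0)[d1 d10 HA]] :=
  analytic_strict_derivative (lie_mul_analytic _ _ _ phiA phiA phiA _ _ phi1 phi1 dom11).
(* The analytic estimate does not keep products inside the chart domain; continuity of
   multiplication does. *)
have [d2 d20 H2] : exists2 d2 : rat, 0 < d2 &
    forall g h, chart_ball phi 1%g d2 g -> chart_ball phi 1%g d2 h -> chart_dom phi (g * h)%g.
  have : nbhs ((1, 1)%g : G * G) ((fun x : G * G => (x.1 * x.2)%g) @^-1` chart_dom phi).
    by apply: mulg_continuous; apply: open_nbhs_nbhs; split; first exact: chart_dom_open.
  move=> [[N1 N2] /= [/(chart_ball_sub phi1)[a a0 aN1] /(chart_ball_sub phi1)[b b0 bN2]] N12].
  exists (Num.min a b); first by rewrite lt_min a0.
  move=> g h gB hB; apply: (N12 (g, h)); split.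
    by apply: aN1; apply: chart_ball_le gB; rewrite ge_min lexx.
  by apply: bN2; apply: chart_ball_le hB; rewrite ge_min lexx orbT.
exists (Num.min d1 d2); first by rewrite lt_min d10.
move=> g g' h h' gB gB' hB hB'; split.
  by apply: H2; [apply: chart_ball_le gB|apply: chart_ball_le hB]; rewrite ge_min lexx orbT.
have dd1 : Num.min d1 d2 <= d1 by rewrite ge_min lexx.
set x0 := phi 1%g in HA.
have HB a a' b b' : chart_ball phi 1%g (Num.min d1 d2) a ->
    chart_ball phi 1%g (Num.min d1 d2) a' -> chart_ball phi 1%g (Num.min d1 d2) b ->
    chart_ball phi 1%g (Num.min d1 d2) b' ->
    vnorm (phi (a * b)%g - phi (a' * b')%g - row_mx (phi a - phi a') (phi b - phi b') *m A)
      <= e * Num.max (vnorm (phi a - phi a')) (vnorm (phi b - phi b')).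
  have small u v : chart_ball phi 1%g (Num.min d1 d2) u ->
      chart_ball phi 1%g (Num.min d1 d2) v -> vnorm (row_mx (phi u - x0) (phi v - x0)) < d1.
    by move=> [_ ud] [_ vd]; exact: vnorm_row_mx_lt (lt_le_trans ud dd1) (lt_le_trans vd dd1).
  move=> aB aB' bB bB'; have := HA _ _ (small _ _ aB bB) (small _ _ aB' bB').
  rewrite !add_row_mx opp_row_mx add_row_mx ![x0 + _]addrCA !subrr !addr0.
  rewrite !row_mxKl !row_mxKr.
  have [[? _] [? _] [? _] [? _]] := And4 aB aB' bB bB'; rewrite !chart_mapK //.
  have subBB (u v : 'rV[Qp p]_(@lie_dim p G)) : u - x0 - (v - x0) = u - v.
    by rewrite opprB addrA subrK.
  rewrite !subBB.
  by move/le_trans; apply; apply: ler_wpM2l (vnorm_row_mx_le _ _); exact: ltW.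
have oneB : chart_ball phi 1%g (Num.min d1 d2) 1%g.
  by apply: chart_ball_center; rewrite // lt_min d10.
have Hg := HB _ _ _ _ gB gB' oneB oneB.
have Hh := HB _ _ _ _ oneB oneB hB hB'.
have Hgh := HB _ _ _ _ gB gB' hB hB'.
rewrite !mulg1 subrr vnorm0 (max_l (vnorm_ge0 _)) in Hg.
rewrite !mul1g subrr vnorm0 (max_r (vnorm_ge0 _)) in Hh.
set u := phi g - phi g' in Hg Hgh *; set v := phi h - phi h' in Hh Hgh *.
have row_split : row_mx u v *m A = row_mx u 0 *m A + row_mx 0 v *m A.
  by rewrite -mulmxDl add_row_mx addr0 add0r.
rewrite row_split in Hgh.
exact: (vnorm_additive_approx (ltW e0) Hg Hh Hgh).
Qed.

(** The difference of k-th powers is [k%:R *: (phi g - phi g')] up to a relative error [e]. For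
    [k = p] and [e] below the norm of [p], the main term determines the norm exactly. *)
Lemma chart_expg_prime p (G : padicLieGroupType p) (phi : chart p G (@lie_dim p G)) :
  prime p -> @lie_atlas p G phi -> chart_dom phi 1%g ->
  exists2 d : rat, 0 < d & forall g g',
    chart_ball phi 1%g d g -> chart_ball phi 1%g d g' ->
    chart_ball phi 1%g d (g ^+ p)%g /\
    vnorm (phi (g ^+ p)%g - phi (g' ^+ p)%g) = p%:R^-1 * vnorm (phi g - phi g').
Proof.
move=> p_prime phiA phi1.
have [e e0 ep] : exists2 e : rat, 0 < e & e < p%:R^-1.
  have pV0 : 0 < p%:R^-1 :> rat by rewrite invr_gt0 ltr0n prime_gt0.
  by exists (p%:R^-1 / 2); [rewrite divr_gt0|rewrite ltr_pdivrMr // ltr_pMr // ltr1n].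
have e1 : e <= 1.
  by rewrite (ltW (lt_le_trans ep _)) // invf_le1 ?ler1n ?ltr0n prime_gt0.
have [d d0 Hd] := chart_mulg_strict phiA phi1 e0.
exists d; first exact: d0.
move=> g g' gB gB'.
have oneB : chart_ball phi 1%g d 1%g by exact: chart_ball_center.
(* Comparing with the product 1 * 1 and using [e <= 1] shows that the ball is closed under
   multiplication. *)
have mulB a b : chart_ball phi 1%g d a -> chart_ball phi 1%g d b -> chart_ball phi 1%g d (a * b)%g.
  move=> aB bB; have [domab] := Hd _ _ _ _ aB oneB bB oneB; rewrite mulg1 => Hab; split=> //.
  have [_ ad] := aB; have [_ bd] := bB.
  by apply: le_lt_trans (vnorm_le_of_additive_approx e1 Hab) _; rewrite gt_max ad; exact: bd.
have expB a k : chart_ball phi 1%g d a -> chart_ball phi 1%g d (a ^+ k)%g.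
  move=> aB; elim: k => [|k IH]; first by rewrite expg0; exact: oneB.
  by rewrite expgS; exact: mulB aB IH.
split; first exact: expB.
rewrite -Qp_norm_p //; apply: (@vnorm_scale_approx _ _ _ _ _ e); first by rewrite Qp_norm_p.
have Hk k : vnorm (phi (g ^+ k)%g - phi (g' ^+ k)%g - k%:R *: (phi g - phi g'))
    <= e * vnorm (phi g - phi g').
  elim: k => [|k IH].
    by rewrite !expg0 subrr scale0r subrr vnorm0 mulr_ge0 ?vnorm_ge0 // ltW.
  rewrite !expgS; have [_ Hk] := Hd _ _ _ _ gB gB' (expB _ k gB) (expB _ k gB').
  by apply: vnorm_multiple_approx_succ Hk IH; rewrite (ltW e0).
exact: Hk.
Qed.

(** * Elements of the kernel of the adjoint representation *)

Lemma is_derivative_chart_id p (X : topologicalType) n (phi : chart p X n) x :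
  chart_dom phi x -> is_derivative (fun u => phi (chart_inv phi u)) (phi x) 1%:M.
Proof.
move=> phix e e0.
have : nbhs (phi x) (phi @` chart_dom phi).
  by apply: open_nbhs_nbhs; split; [exact: chart_img_open|exists x].
move=> /nbhs_vnormP[d d0 Hd]; exists d; first exact: d0.
move=> h /Hd[y phiy yE]; rewrite -yE !chart_mapK // yE mulmx1.
by rewrite [phi x + h]addrC addrK subrr vnorm0 mulr_ge0 ?vnorm_ge0 // ltW.
Qed.

(** Unfolding [ker_Ad] in the chart [phi] gives h = hDE, where [D] and [E] are picked by [xget] and
    [E] is a derivative of a map that is the identity near [phi 1]. Hence h - hE = o(h), and hD - h
    = hD - hDE = o(h). *)
Lemma ker_Ad_derivative p (G : padicLieGroupType p) (phi : chart p G (@lie_dim p G)) (g : G) :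
  @lie_atlas p G phi -> chart_dom phi 1%g -> @ker_Ad p G g ->
  is_derivative (fun u => phi (g * chart_inv phi u * g^-1)%g) (phi 1%g) 1%:M.
Proof.
move=> phiA phi1 gAd; set f := fun u => _.
pose D := derivative f (phi 1%g).
pose E := derivative (fun u => phi (chart_inv phi u)) (phi 1%g).
have DE v : v = v *m D *m E := gAd (Tangent1 phiA phi1 v).
have ED : is_derivative (fun u => phi (chart_inv phi u)) (phi 1%g) E.
  rewrite /E /derivative; case: xgetP => // noE.
  by case: (noE 1%:M); exact: is_derivative_chart_id.
have E1 e : 0 < e -> exists2 d : rat, 0 < d &
    forall h, vnorm h < d -> vnorm (h - h *m E) <= e * vnorm h.
  move=> e0; have [d1 d10 H1] := ED e e0.
  have : nbhs (phi 1%g) (phi @` chart_dom phi).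
    by apply: open_nbhs_nbhs; split; [exact: chart_img_open|exists 1%g].
  move=> /nbhs_vnormP[d3 d30 H3].
  exists (Num.min d1 d3); first by rewrite lt_min d10.
  move=> h; rewrite lt_min => /andP[/H1 + /H3[y phiy yE]].
  by rewrite -yE !chart_mapK // yE [phi 1%g + h]addrC addrK.
move=> e e0; have : D = derivative f (phi 1%g) by [].
rewrite /derivative; case: xgetP => [D' _ fD DD'|_ D0]; last first.
  (* Without a derivative D is 0 by convention, and DE forces dimension 0. *)
  have v0 (v : 'rV[Qp p]_(@lie_dim p G)) : v = 0.
    by rewrite [v]DE D0 mulmx0 mul0mx.
  exists 1; first exact: ltr01.
  by move=> h _; rewrite [X in vnorm X]v0 vnorm0 mulr_ge0 ?vnorm_ge0 // ltW.
move: fD; rewrite -DD' => /(_ e e0)[d1 d10 H1].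
have [C C0 HC] := vnorm_mulmx_bound D.
have [d2 d20 H2] := E1 (e / C) (divr_gt0 e0 C0).
(* The bound [d2 / C] puts [h *m D] within the range of [H2]; the factor [C] then cancels against
   [e / C]. *)
exists (Num.min d1 (d2 / C)); first by rewrite lt_min d10 divr_gt0.
move=> h; rewrite lt_min ltr_pdivlMr // mulrC => /andP[hd1 hd2].
have -> : f (phi 1%g + h) - f (phi 1%g) - h *m 1%:M
    = (f (phi 1%g + h) - f (phi 1%g) - h *m D) + (h *m D - h *m D *m E).
  by rewrite addrA subrK mulmx1 -DE.
apply: vnormD_le; first exact: H1.
apply: le_trans (H2 _ (le_lt_trans (HC h) hd2)) _.
by rewrite -mulrA ler_pM2l // ler_pdivrMl.
Qed.

Lemma exprVn_small (p : nat) (x d : rat) : (1 < p)%N -> 0 <= x -> 0 < d ->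
  exists n, p%:R ^- n * x < d.
Proof.
move=> p1 x0 d0; have := archi_boundP (divr_ge0 x0 (ltW d0)).
set n := Num.bound _ => xn; exists n.
rewrite -ltr_pdivlMl ?invr_gt0 ?exprn_gt0 ?ltr0n ?(ltnW p1) // invrK.
rewrite -ltr_pdivrMr //; apply: lt_trans xn _.
by rewrite -natrX ltr_nat ltn_expl.
Qed.

Lemma mulg_continuousl (G : topologicalGroupType) (g : G) : continuous (fun x : G => (g * x)%g).
Proof.
move=> x; apply: (@continuous_comp _ _ _ (fun y => (g, y)) (fun z : G * G => (z.1 * z.2)%g)).
  by apply: cvg_pair; [exact: cvg_cst|exact: cvg_id].
exact: mulg_continuous.
Qed.

Lemma mulg_continuousr (G : topologicalGroupType) (g : G) : continuous (fun x : G => (x * g)%g).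
Proof.
move=> x; apply: (@continuous_comp _ _ _ (fun y => (y, g)) (fun z : G * G => (z.1 * z.2)%g)).
  by apply: cvg_pair; [exact: cvg_id|exact: cvg_cst].
exact: mulg_continuous.
Qed.

Lemma conjg_expg (G : groupType) (g x : G) n : ((g * x * g^-1) ^+ n = g * x ^+ n * g^-1)%g.
Proof.
elim: n => [|n IH]; first by rewrite !expg0 mulg1 mulgV.
by rewrite !expgS IH !mulgA mulgVK.
Qed.

Lemma ker_Ad_centralizes_nbhs p (G : padicLieGroupType p) (g : G) :
  prime p -> @ker_Ad p G g -> nbhs (1%g : G) [set x | (g * x = x * g)%g].
Proof.
move=> p_prime gAd; have [phi phiA phi1] := @lie_atlas_cover p G 1%g.
have [d d0 Hd] := chart_expg_prime p_prime phiA phi1.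
have oneB : chart_ball phi 1%g d 1%g by exact: chart_ball_center.
have Hn n a b : chart_ball phi 1%g d a -> chart_ball phi 1%g d b ->
    chart_ball phi 1%g d (a ^+ (p ^ n))%g /\
    vnorm (phi (a ^+ (p ^ n))%g - phi (b ^+ (p ^ n))%g) = p%:R ^- n * vnorm (phi a - phi b).
  elim: n a b => [|n IH] a b aB bB.
    by rewrite expn0 !expg1 expr0 invr1 mul1r.
  have [aB' ab'] := IH a b aB bB; have [bB' _] := IH b a bB aB.
  rewrite expnSr !expgnA; have [abB ->] := Hd _ _ aB' bB'.
  split; first exact: abB.
  by rewrite ab' mulrA exprS invfM.
have conjB : nbhs (1%g : G) [set x | chart_ball phi 1%g d (g * x * g^-1)%g].
  have cont : continuous (fun x : G => (g * x * g^-1)%g).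
    move=> x; apply: (@continuous_comp _ _ _ (fun y => (g * y)%g) (fun y => (y * g^-1)%g)).
      exact: mulg_continuousl.
    exact: mulg_continuousr.
  by move: (cont 1%g); rewrite /continuous_at mulg1 mulgV; apply; exact: nbhs_chart_ball.
(* The neighbourhood consists of the [x] in the ball whose conjugate by [g] is also in the ball, so
   that [Hn] applies to both. *)
apply: filterS (filterI conjB (nbhs_chart_ball phi1 d0)) => x [+ xB].
rewrite /mkset => cB.
suff conjx : (g * x * g^-1 = x)%g by rewrite /= -{2}conjx mulgVK.
suff phix : vnorm (phi (g * x * g^-1)%g - phi x) = 0.
  have [domc _] := cB; have [domx _] := xB.
  move/vnorm_eq0/eqP: phix; rewrite subr_eq0 => /eqP phix.
  by rewrite -[LHS](chart_mapK domc) phix chart_mapK.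
have p_gt0 n : 0 < p%:R ^- n :> rat by rewrite invr_gt0 exprn_gt0 // ltr0n prime_gt0.
(* Take [n] so large that [x ^+ (p ^ n)] is in the range of the derivative estimate. Both sides of
   that estimate carry the factor [p%:R ^- n], which cancels and leaves a bound on [x] itself. *)
have key e : 0 < e -> vnorm (phi (g * x * g^-1)%g - phi x) <= e * vnorm (phi x - phi 1%g).
  move=> e0; have [d1 d10 H1] := ker_Ad_derivative phiA phi1 gAd e0.
  have [n xn] := exprVn_small (prime_gt1 p_prime) (vnorm_ge0 (phi x - phi 1%g)) d10.
  have [[domxn _] xnE] := Hn n x 1%g xB oneB.
  have [_ cnE] := Hn n (g * x * g^-1)%g x cB xB.
  rewrite expg1n in xnE.
  have := H1 (phi (x ^+ (p ^ n))%g - phi 1%g); rewrite xnE => /(_ xn).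
  rewrite [phi 1%g + _]addrC subrK !chart_mapK // mulg1 mulgV mulmx1.
  rewrite opprB addrA subrK -conjg_expg cnE mulrCA ler_pM2l //.
apply/le_anti; rewrite vnorm_ge0 andbT; set y := vnorm _.
apply/ler_addgt0Pl => e e0; rewrite addr0.
have N0 := vnorm_ge0 (phi x - phi 1%g).
apply: le_trans (key (e / (vnorm (phi x - phi 1%g) + 1)) _) _.
  by rewrite divr_gt0 // ltr_wpDl.
by rewrite mulrAC ler_pdivrMr ?ltr_wpDl // ler_pM2l // lerDl.
Qed.

(** * Discrete and open subgroups *)

Lemma filter_least_vspace (K : fieldType) (V : vectType K) (T : Type) (F : set_system T)
    (f : T -> V) : Filter F ->
  exists (A : set T) (W : {vspace V}), [/\ F A, forall x, A x -> f x \in W &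
    forall (B : set T) (U : {vspace V}), F B -> (forall x, B x -> f x \in U) -> (W <= U)%VS].
Proof.
move=> FF; pose P k := `[< exists (A : set T) (W : {vspace V}),
  [/\ F A, forall x, A x -> f x \in W & \dim W = k] >].
have exP : exists k, P k.
  exists (\dim {:V}); apply/asboolP; exists setT, fullv; split=> //; first exact: filterT.
  by move=> x _; rewrite memvf.
case: (ex_minnP exP) => _ /asboolP[A [W [FA AW <-]]] minW.
exists A, W; split=> // B U FB BU.
have : P (\dim (W :&: U)).
  apply/asboolP; exists (A `&` B), (W :&: U)%VS; split=> //; first exact: filterI.
  by move=> x [Ax Bx]; rewrite memv_cap AW ?BU.
(* W has minimal dimension, so W :&: U cannot be smaller. *)
move/minW => dimW; apply/capv_idPl/eqP.
by rewrite eqEdim capvSl.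
Qed.


Lemma is_subgroup_mul (G : topologicalGroupType) (S : set G) x y :
  is_subgroup S -> S x -> S y -> S (x * y)%g.
Proof.
move=> [S1 SV] Sx Sy; rewrite -[y]invgK; apply: (SV _ _ Sx).
by rewrite -[y^-1%g]mul1g; exact: SV.
Qed.

Lemma subgroup_open (G : topologicalGroupType) (S : set G) :
  is_subgroup S -> nbhs (1%g : G) S -> open S.
Proof.
move=> Ssub S1; rewrite openE => x Sx.
have : nbhs x ((fun y : G => (x^-1 * y)%g) @^-1` S).
  by apply: mulg_continuousl; rewrite mulVg.
apply: filterS => y /= Sy.
by rewrite -[y](mulVKg x); exact: is_subgroup_mul Ssub Sx Sy.
Qed.

Lemma discrete_set_sub (G : topologicalGroupType) (S T : set G) :
  S `<=` T -> discrete_set T -> discrete_set S.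
Proof.
move=> ST dT x Sx; have [_ [V Vx VT]] := dT x (ST x Sx).
split; [exact/mem_set|exists V => //; apply/seteqP; split=> y].
  by move=> [Vy Sy]; rewrite -VT; split=> //; exact: ST.
by move=> ->; split=> //; exact: nbhs_singleton.
Qed.

Lemma commutator_group_sub (G : topologicalGroupType) (S K : set G) : is_subgroup K ->
  (forall x y, S x -> S y -> K (x * y * x^-1 * y^-1)%g) -> commutator_group S `<=` K.
Proof.
move=> Ksub SK; apply: smallest_sub => // _ [[x y] [/= Sx Sy] <-]; exact: SK.
Qed.

(** The coset xZ is open in [K] because the quotient is discrete, and the translate by [x] of a
    neighbourhood isolating 1 in [Z] isolates [x] in that coset. *)
Lemma discrete_extension (G : topologicalGroupType) (Z K : set G) :
  normal_in Z K -> discrete_quotient K Z -> discrete_set Z -> discrete_set K.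
Proof.
move=> [Zsub Ksub ZK _] KZ dZ x Kx; split; first exact/mem_set.
have [_ [W W1 WZ]] := dZ 1%g (proj1 Zsub).
have [|a z Aa Zz|U Uopen UE] := KZ [set y | Z (x^-1 * y)%g].
- move=> y /ZK Ky; rewrite -[y](mulVKg x); exact: is_subgroup_mul.
- by rewrite /= mulgA; exact: is_subgroup_mul.
have Ux : (U `&` K) x by rewrite -UE /= mulVg; case: Zsub.
exists (U `&` (fun y : G => (x^-1 * y)%g) @^-1` W).
  apply: filterI; first by apply: open_nbhs_nbhs; split=> //; case: Ux.
  by apply: mulg_continuousl; rewrite mulVg.
apply/seteqP; split=> y /=.
  move=> [[Uy Wy] Ky]; have Zy : [set y | Z (x^-1 * y)%g] y by rewrite UE.
  have : (W `&` Z) (x^-1 * y)%g by [].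
  by rewrite WZ => /= xy; rewrite -[y](mulVKg x) xy mulg1.
move=> ->; rewrite mulVg; case: Ux => Ux _; split=> //; split=> //.
exact: nbhs_singleton.
Qed.

(** * Homomorphisms into GL_d and elements with central image *)

Lemma GL_hom1 p d (G : topologicalGroupType) (beta : G -> 'M[Qp p]_d) :
  continuous_GL_hom beta -> beta 1%g = 1%:M.
Proof.
move=> [_ U M]; have := M 1%g 1%g; rewrite mulg1 => e.
by rewrite -[LHS](mulKmx (U 1%g)) -e mulVmx.
Qed.

Lemma GL_hom_commutator p d (G : topologicalGroupType) (beta : G -> 'M[Qp p]_d) x y :
  continuous_GL_hom beta -> comm_mx (beta x) (beta y) ->
  beta (x * y * x^-1 * y^-1)%g = 1%:M.
Proof.
move=> beta_hom xy; have [_ U M] := beta_hom.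
by rewrite 2!M M xy -M -!M mulgK mulgV (GL_hom1 beta_hom).
Qed.

Definition central_preimage p d (G : Type) (beta : G -> 'M[Qp p]_d) : set G :=
  [set g | forall h, comm_mx (beta g) (beta h)].

Lemma central_preimage_normal p d (G : topologicalGroupType) (beta : G -> 'M[Qp p]_d) :
  continuous_GL_hom beta -> normal_in (central_preimage beta) setT.
Proof.
move=> beta_hom; have [_ U M] := beta_hom.
have comm_inv x A : comm_mx (beta x) A -> comm_mx (beta x^-1%g) A.
  move=> xA; have xV : beta x^-1%g *m beta x = 1%:M by rewrite -M mulVg (GL_hom1 beta_hom).
  have xV' : beta x *m beta x^-1%g = 1%:M by rewrite -M mulgV (GL_hom1 beta_hom).
  rewrite /comm_mx -[A in LHS]mulmx1 -xV' !mulmxA -[_ *m A *m beta x]mulmxA -xA.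
  by rewrite !mulmxA xV mul1mx.
split=> //.
- split=> [h|x y Sx Sy h]; first by rewrite /comm_mx (GL_hom1 beta_hom) mul1mx mulmx1.
  by rewrite /comm_mx M mulmxA -(Sx h) -!mulmxA (comm_inv _ _ (Sy h)).
- move=> k n _ Sn h; suff -> : beta (k * n * k^-1)%g = beta n by exact: Sn.
  by rewrite !M -Sn -mulmxA -M mulgV (GL_hom1 beta_hom) mulmx1.
Qed.

Lemma central_preimage_nbhs p d (H : padicLieGroupType p) (beta : H -> 'M[Qp p]_d) :
  prime p -> @ker_Ad p H = setT -> continuous_GL_hom beta ->
  nbhs (1%g : H) (central_preimage beta).
Proof.
move=> p_prime AdT [_ U M].
have [A [W [A1 AW Wmin]]] := filter_least_vspace beta (nbhs_filter (1%g : H)).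
(* [A] and [W] are fixed before [h], so one neighbourhood serves all [h]. *)
apply: filterS A1 => g Ag h.
(* [C] is the commutant of [beta h], written as a kernel to make it a subspace. Near 1 all elements
   commute with [h], so [beta] takes values in [C] there and the least subspace [W] lies in [C]. *)
pose C := lker (linfun (mulmxr (beta h)) - linfun (mulmx (beta h)) : 'End('M[Qp p]_d)).
have CE X : (X \in C) = (X *m beta h == beta h *m X).
  by rewrite memv_ker add_lfunE opp_lfunE !lfunE /= subr_eq0.
have hAd : @ker_Ad p H h by rewrite AdT.
have WC : (W <= C)%VS.
  apply: (Wmin _ _ (ker_Ad_centralizes_nbhs p_prime hAd)) => x /= hx.
  by rewrite CE -!M hx.
by apply/eqP; rewrite -CE; exact: (subvP WC) (AW _ Ag).
Qed.

Theorem mainTheorem3 (p : nat) (p_prime : prime p)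
    (structure_hyp : forall G : padicLieGroupType p,
      exists Z K : set G,
        [/\ closed Z /\ closed K,
            normal_in Z K /\ normal_in K setT,
            abelian_set Z,
            discrete_quotient K Z &
            exists (d : nat) (beta : G -> 'M[Qp p]_d),
              [/\ (0 < d)%N, continuous_GL_hom beta &
                  K = [set g | beta g = 1%:M]]]) :
  ~ exists H : padicLieGroupType p, extraordinary H.
Proof.
move=> [H [H_simple AdT H_nondiscrete]].
have [Z [K [[Zclosed _] [ZK KH] Zab KZ [d [beta [_ beta_hom KE]]]]]] := structure_hyp H.
have Zsubnormal : subnormal Z.
  exists 2%N, (fun i => if i is i'.+1 then if i' is _.+1 then Z else K else setT).
  by split=> // -[|[|]].
have dZ : discrete_set Z.
  (* If [Z] were open, its commutator group, trivial because [Z] is abelian, would have to be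
     non-discrete. *)
  case: (H_simple Z Zclosed Zsubnormal) => // Zopen.
  case: (H_nondiscrete Z Zopen Zsubnormal); apply: (@discrete_set_sub _ _ [set 1%g]).
    apply: commutator_group_sub => [|x y Zx Zy].
      by split=> // x y /= -> ->; rewrite mulgV.
    by rewrite /= (Zab x y) // mulgK mulgV.
  move=> _ ->; split; first exact/mem_set.
  by exists setT; [exact: filterT|rewrite setTI].
have dK := discrete_extension ZK KZ dZ.
have V_normal := central_preimage_normal beta_hom.
have Vopen : open (central_preimage beta).
  apply: subgroup_open; first by case: V_normal.
  exact: central_preimage_nbhs.
apply: (H_nondiscrete _ Vopen).
  exists 1%N, (fun i => if i is 0 then setT else central_preimage beta).
  by split=> // -[].
(* Commutators of elements with central image lie in the kernel of [beta], which is the discrete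
   group [K]. *)
apply: discrete_set_sub dK; rewrite KE.
apply: commutator_group_sub => [|x y Vx Vy]; last exact: GL_hom_commutator.
by rewrite -KE; case: KH.
Qed.
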